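(* For every complex number $q$ with $|q|<1$ (and $q\neq 0$ in the second identity), \begin{align*} \sum_{i,j,k\ge 0}\frac{q^{\frac{3}{2}i^2+2j^2+4k^2+2ij+4ik+4jk+\frac{1}{2}i+j}}{(q;q)_i(q^2;q^2)_j(q^2;q^2)_k}&=\frac{1}{4}\left(3\frac{(q^2;q^2)_\infty}{(q;q)_\infty}+\frac{(q;q)_\infty^3}{(q^2;q^2)_\infty}\right),\\ \sum_{i,j,k\ge 0}\frac{q^{\frac{3}{2}i^2+2j^2+4k^2+2ij+4ik+4jk+\frac{5}{2}i+3j+4k}}{(q;q)_i(q^2;q^2)_j(q^2;q^2)_k}&=\frac{1}{4}q^{-1}\left(\frac{(q^2;q^2)_\infty}{(q;q)_\infty}-\frac{(q;q)_\infty^3}{(q^2;q^2)_\infty}\right). \end{align*}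
   Context: Notation: for $n\in\mathbb{Z}_{\ge 0}$, $(a;p)_n=\prod_{k=0}^{n-1}(1-ap^k)$; for $|p|<1$, $(a;p)_\infty=\prod_{k=0}^\infty(1-ap^k)$. Sums are over nonnegative integers; all exponents of $q$ appearing in the sums are integers. *)

(* Defs.v *)
From HB Require Import structures.
From mathcomp Require Import all_boot all_order all_algebra finmap complex.
From mathcomp Require Import all_classical all_reals all_analysis.
From mathcomp Require Import showcase.summability.

Set Implicit Arguments.
Unset Strict Implicit.
Unset Printing Implicit Defensive.

Import Order.TTheory GRing.Theory Num.Theory numFieldNormedType.Exports.

Local Open Scope classical_set_scope.
Local Open Scope ring_scope.

(* The library puts the norm topology on every abstract numFieldType, but this
   is not found by unification for the concrete type R[i]; we transfer it. *)
HB.instance Definition _ (R : realType) :=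
  NormedModule.copy R[i] (R[i] : numFieldType).

Section QPochhammer.
Variable R : realType.
Implicit Types a p l : R[i].

(* (a; p)_n *)
Definition qpoch a p (n : nat) : R[i] := \prod_(k < n) (1 - a * p ^+ k).

(* (a; p)_oo, meaningful for |p| < 1, where the partial products converge *)
Definition qpoch_inf a p : R[i] := limn (qpoch a p).

(* The family f, indexed by nat ^ 3, is unconditionally (over R[i],
   equivalently absolutely) summable, with sum l: its partial sums over the
   finite subsets of nat ^ 3, directed by inclusion, converge to l. *)
Definition sum3_is (f : nat -> nat -> nat -> R[i]) l : Prop :=
  partial_sum (fun t : nat * nat * nat => f t.1.1 t.1.2 t.2) @ totally --> l.

End QPochhammer.

(* The half-integral parts 3/2 i^2 + 1/2 i and 3/2 i^2 + 5/2 i of the exponents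
   are natural numbers, so that their encodings with %/ 2 are exact. *)
Lemma dvdn2_exponent1 (i : nat) : (2 %| 3 * i ^ 2 + i)%N.
Proof. by rewrite dvdn2 oddD oddM oddX /= addbb. Qed.

Lemma dvdn2_exponent2 (i : nat) : (2 %| 3 * i ^ 2 + 5 * i)%N.
Proof. by rewrite dvdn2 oddD !oddM /= andbb addbb. Qed.

(* Main.v *)
Require Import Defs.
From mathcomp Require Import all_boot all_order all_algebra finmap complex.
From mathcomp Require Import all_classical all_reals all_analysis.
From mathcomp Require Import showcase.summability.
From mathcomp Require Import ring lra zify.

(**
Write [(a)_n] for [(a; q)_n], [p] for [q^2], and [M = i + 2k + 2j],
[N = i + 2k]. The quadratic form splits as [(M^2 + N^2 + i^2) / 2], so the first
summand is

  [q^C(M+1,2) q^C(N,2) q^C(i+1,2) / ((q)_i (p;p)_j (p;p)_k)],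

and the second one has the extra factor [q^(M + N)]. Put

  [a_N = sum_(i + 2k = N) q^C(i+1,2) / ((q)_i (p;p)_k)],
  [c_M = sum_(N + 2j = M) q^C(N,2) a_N / (p;p)_j],
  [c'_M = sum_(N + 2j = M) q^(C(N,2) + N) a_N / (p;p)_j].

These are Cauchy products with the coefficients of [1 / (z^2; q^2)_oo], and
comparing coefficients gives [a_n + a_(n-1) = 1 / (q)_n] ([acoefD]), hence

  [1 / (q)_n = c_n + c'_(n-1)] and [c'_n - c'_(n-2) = q^n c_n]

([rpoch_ccoef], [ccoef2B]). So with
[E(x) = sum_n q^C(n+1,2) x^n / (q)_n] and
[W(x) = sum_n q^C(n+1,2) x^n c'_(n-1)], the first triple sum is [E(1) - W(1)],
the second one is [W(1) / q], and

  [E(x) = (1 + x q) E(x q)],  [W(x) = x q (E(x p) - (1 - x p) W(x p))]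

([Esum_eq], [Wsum_eq]). The first equation gives [E(1) = (-q)_oo]. At the
points [x = p^s], the series [x q E(x) F_s], with

  [F_s = sum_n (-p;p)_n (-p;p)_s / (-p;p)_(n+s+1) (- q x)^n],

satisfies the equation of [W] by a telescoping argument ([Fterm_telescope]).
Iterating the homogeneous equation of the difference, whose factors are
[- q^(2s+1) (1 - p^(s+1))], shows that the two agree: [W(1) = q E(1) F_0]
([Wsum1]), where [F_0 = sum_n (-q)^n / (1 + q^(2n+2))] is a Lambert series.

What remains is Jacobi's two-squares identity
[((q)_oo / (-q)_oo)^2 = 1 - 4 q F_0] ([two_squares]). With
[r_m = (-q)_m / (q)_m], it is the limit of the finite identity

  [r_N^2 + 4 sum_(1 <= n <= N) (-q)^n / (1 + q^(2n)) r_(N+n) r_(N-n) = 1]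

([two_squares_fin]), proved by induction on [N], as the increments telescope.

Unconditional convergence is obtained from the exhaustion of [nat^3] by the
sets [M < N] ([sum3_is_triples]): the tails are bounded by those of the same
sums at [|q|], whose terms are nonnegative and, for each fixed [M], add up to at
most [B |q|^M] with [B] independent of [M].
*)

Set Implicit Arguments.
Unset Strict Implicit.
Unset Printing Implicit Defensive.

Import Order.TTheory GRing.Theory Num.Theory numFieldNormedType.Exports.

Local Open Scope ring_scope.

(** * Cauchy products of sequences *)

(** Multiplication by [z] of the generating function of [f]. *)
Definition delay (V : nmodType) (f : nat -> V) (n : nat) : V :=
  if n is m.+1 then f m else 0.

(** Coefficients of the product of two generating functions. *)
Definition cprod (F : pzRingType) (f g : nat -> F) (n : nat) : F :=
  \sum_(i < n.+1) f i * g (n - i)%N.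

Section Conv.
Variable F : comPzRingType.
Implicit Types f g : nat -> F.

Lemma eq_cprod f f' g g' : f =1 f' -> g =1 g' -> cprod f g =1 cprod f' g'.
Proof. by move=> ff' gg' n; apply: eq_bigr => i _; rewrite ff' gg'. Qed.

Lemma cprodDl f f' g n : cprod (fun i => f i + f' i) g n = cprod f g n + cprod f' g n.
Proof. by rewrite -big_split /=; apply: eq_bigr => i _; rewrite mulrDl. Qed.

Lemma cprodBr f g g' n : cprod f (fun i => g i - g' i) n = cprod f g n - cprod f g' n.
Proof. by rewrite -sumrB /=; apply: eq_bigr => i _; rewrite mulrBr. Qed.

Lemma cprod_delayl f g : cprod (delay f) g =1 delay (cprod f g).
Proof.
case=> [|n]; rewrite /cprod; first by rewrite big_ord1 mul0r.
by rewrite big_ord_recl mul0r add0r; apply: eq_bigr => i _ /=; rewrite subSS.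
Qed.

Lemma cprod_delayr f g : cprod f (delay g) =1 delay (cprod f g).
Proof.
case=> [|n]; rewrite /cprod; first by rewrite big_ord1 mulr0.
rewrite big_ord_recr /= subnn mulr0 addr0; apply: eq_bigr => i _ /=.
by rewrite subSn // -ltnS.
Qed.

Lemma eq_delay f g : f =1 g -> delay f =1 delay g.
Proof. by move=> fg [|n] /=. Qed.

(** The substitution [z := q z] is multiplicative on generating functions. *)
Lemma cprod_expr (q : F) f g n :
  q ^+ n * cprod f g n = cprod (fun i => q ^+ i * f i) (fun i => q ^+ i * g i) n.
Proof.
rewrite mulr_sumr; apply: eq_bigr => i _.
have -> : q ^+ n = q ^+ i * q ^+ (n - i) by rewrite -exprD subnKC // -ltnS.
ring.
Qed.

End Conv.

(** * The exponents *)

Lemma binS2 n : 'C(n.+1, 2) = ('C(n, 2) + n)%N.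
Proof. by rewrite binS bin1. Qed.

Lemma muln2_bin2 n : ('C(n, 2) * 2 = n * n.-1)%N.
Proof. by elim: n => // n IH; rewrite binS2 mulnDl IH; case: n {IH} => //= n; lia. Qed.

Lemma exponent1E i j k :
  ((3 * i ^ 2 + i) %/ 2 + 2 * j ^ 2 + 4 * k ^ 2
   + 2 * i * j + 4 * i * k + 4 * j * k + j)%N =
  ('C((i + 2 * k + 2 * j).+1, 2) + 'C(i + 2 * k, 2) + 'C(i.+1, 2))%N.
Proof.
have h : (3 * i ^ 2 + i = 2 * ('C(i.+1, 2) + i ^ 2))%N.
  by have := muln2_bin2 i.+1 => /=; lia.
rewrite h mulKn //.
have h1 := muln2_bin2 (i + 2 * k + 2 * j).+1.
have h2 := muln2_bin2 (i + 2 * k).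
have h3 : ((i + 2 * k) * (i + 2 * k).-1 + (i + 2 * k)
           = (i + 2 * k) * (i + 2 * k))%N.
  by rewrite -mulnSr; case: (i + 2 * k)%N.
move: h1 h2 h3 => /=; nia.
Qed.

Lemma exponent2E i j k :
  ((3 * i ^ 2 + 5 * i) %/ 2 + 2 * j ^ 2 + 4 * k ^ 2
   + 2 * i * j + 4 * i * k + 4 * j * k + 3 * j + 4 * k)%N =
  ('C((i + 2 * k + 2 * j).+1, 2) + (i + 2 * k + 2 * j)
   + ((i + 2 * k) + 'C(i + 2 * k, 2)) + 'C(i.+1, 2))%N.
Proof.
have -> : (3 * i ^ 2 + 5 * i = 2 * i * 2 + (3 * i ^ 2 + i))%N by lia.
rewrite divnMDl //; have := exponent1E i j k; lia.
Qed.

(** * The recurrences of the inner sums *)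

(** [(a; p)_n] in any ring; over [R[i]] it is [qpoch a p n] by definition. *)
Definition qprod (F : pzRingType) (a p : F) (n : nat) : F :=
  \prod_(k < n) (1 - a * p ^+ k).

Lemma qprodS (F : pzRingType) (a p : F) n :
  qprod a p n.+1 = qprod a p n * (1 - a * p ^+ n).
Proof. by rewrite /qprod big_ord_recr. Qed.

Lemma qprod0 (F : pzRingType) (a p : F) : qprod a p 0 = 1.
Proof. by rewrite /qprod big_ord0. Qed.

(** The coefficients of [g(z^2)], where [g] is the generating function of
    [delta]. *)
Definition spread (F : nmodType) (delta : nat -> F) (n : nat) : F :=
  if odd n then 0 else delta n./2.

Section Algebra.
Variables (F : fieldType) (q : F).
Hypothesis q_nunity : forall n, 1 - q ^+ n.+1 != 0.
Local Notation p := (q ^+ 2).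

(** Coefficients of [1 / (z; q)_oo]. *)
Definition rpoch (n : nat) : F := (qprod q q n)^-1.

(** Coefficients of [1 / (z^2; q^2)_oo]. *)
Definition dpoch : nat -> F := spread (fun j => (qprod p p j)^-1).

Lemma rpochS n : (1 - q ^+ n) * rpoch n = delay rpoch n.
Proof.
case: n => [|n]; first by rewrite subrr mul0r.
rewrite /= /rpoch qprodS -exprS invfM mulrCA mulfV ?mulr1 //.
Qed.

Lemma dpochS n : (1 - q ^+ n) * dpoch n = delay (delay dpoch) n.
Proof.
case: n => [|[|n]] /=; first by rewrite subrr mul0r.
  by rewrite /dpoch /spread /= mulr0.
rewrite /dpoch /spread /= negbK; case: ifP => on; first by rewrite mulr0.
rewrite qprodS -exprS -exprM.
have -> : (2 * n./2.+1 = n.+2)%N by have := odd_double_half n; rewrite on; lia.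
by rewrite invfM mulrCA mulfV ?mulr1.
Qed.

(** Coefficients of [(- z q; q)_oo]. *)
Definition ecoef (n : nat) : F := q ^+ 'C(n.+1, 2) * rpoch n.

Lemma ecoefS n : (1 - q ^+ n) * ecoef n = q ^+ n * delay ecoef n.
Proof.
rewrite /ecoef mulrCA rpochS; case: n => [|n] /=; first by rewrite !mulr0.
by rewrite [in LHS]binS2 exprD; ring.
Qed.

(** The sums over [i + 2k = n], free of the factors depending on [n] alone. *)
Definition acoef := cprod ecoef dpoch.

Lemma acoefS n :
  (1 - q ^+ n) * acoef n = delay (delay acoef) n + q ^+ n * delay acoef n.
Proof.
have -> : delay (delay acoef) n = cprod ecoef (fun m => dpoch m - q ^+ m * dpoch m) n.
  rewrite -(eq_delay (cprod_delayr _ _)) -cprod_delayr; apply: eq_cprod => // m.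
  by rewrite -dpochS mulrBl mul1r.
have -> : q ^+ n * delay acoef n =
    cprod (fun i => ecoef i - q ^+ i * ecoef i) (fun m => q ^+ m * dpoch m) n.
  rewrite -cprod_delayl cprod_expr; apply: eq_cprod => // i.
  by rewrite -ecoefS mulrBl mul1r.
rewrite mulrBl mul1r /acoef cprod_expr cprodBr cprodDl.
have -> : cprod (fun i => - (q ^+ i * ecoef i)) (fun m => q ^+ m * dpoch m) n =
   - cprod (fun i => q ^+ i * ecoef i) (fun m => q ^+ m * dpoch m) n.
  by rewrite -sumrN; apply: eq_bigr => i _; rewrite mulNr.
ring.
Qed.

(** In generating functions:
    [(- z q; q)_oo / (z^2; q^2)_oo = 1 / ((1 + z) (z; q)_oo)]. *)
Lemma acoefD n : acoef n + delay acoef n = rpoch n.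
Proof.
elim: n => [|n IH].
  rewrite /acoef /cprod big_ord1 /ecoef /dpoch /spread /rpoch /= !qprod0 expr0.
  by rewrite invr1 !mulr1 addr0.
apply: (mulfI (q_nunity n)); rewrite rpochS /= -IH mulrDr.
rewrite acoefS /=; ring.
Qed.

(** The summands over [N = i + 2k], without the factors depending on [M] alone. *)
Definition hcoef n := q ^+ 'C(n, 2) * acoef n.

(** The sums over [N + 2j = M] in the first and in the second triple sum, up to a
    factor depending on [M] alone. *)
Definition ccoef := cprod hcoef dpoch.
Definition ccoef2 := cprod (fun n => q ^+ n * hcoef n) dpoch.

Lemma ccoef2B n : ccoef2 n - delay (delay ccoef2) n = q ^+ n * ccoef n.
Proof.
rewrite -(eq_delay (cprod_delayr _ _)) -cprod_delayr /ccoef cprod_expr -cprodBr.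
by apply: eq_cprod => // m; rewrite -dpochS; ring.
Qed.

(** In generating functions:
    [(- z; q)_oo / (z^2; q^2)_oo = 1 / (z; q)_oo]. *)
Lemma rpoch_cprod n :
  cprod (fun i => q ^+ 'C(i, 2) * rpoch i) dpoch n = rpoch n.
Proof.
set g := fun i => _; set s := cprod g dpoch.
have gS i : g i - q ^+ i * g i = delay (fun k => q ^+ k * g k) i.
  rewrite -[X in X - _]mul1r -mulrBl /g mulrCA rpochS.
  by case: i => [|i] /=; rewrite ?mulr0 // binS2 exprD; ring.
have sS n' : (1 - q ^+ n') * s n' =
    delay (delay s) n' + delay (fun k => q ^+ k * s k) n'.
  have -> : delay (delay s) n' = cprod g (fun m => dpoch m - q ^+ m * dpoch m) n'.
    rewrite -(eq_delay (cprod_delayr _ _)) -cprod_delayr; apply: eq_cprod => // m.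
    by rewrite -dpochS mulrBl mul1r.
  have -> : delay (fun k => q ^+ k * s k) n' =
    cprod (fun i => g i - q ^+ i * g i) (fun m => q ^+ m * dpoch m) n'.
    rewrite (eq_cprod (f' := delay (fun k => q ^+ k * g k))
      (g' := fun m => q ^+ m * dpoch m)) // cprod_delayl; apply: eq_delay => m.
    exact: cprod_expr.
  rewrite mulrBl mul1r /s cprod_expr cprodBr cprodDl.
  have -> : cprod (fun i => - (q ^+ i * g i)) (fun m => q ^+ m * dpoch m) n' =
     - cprod (fun i => q ^+ i * g i) (fun m => q ^+ m * dpoch m) n'.
    by rewrite -sumrN; apply: eq_bigr => i _; rewrite mulNr.
  ring.
suff : s n = rpoch n /\ s n.+1 = rpoch n.+1 by case.
elim: n => [|n [IH1 IH2]].
  have s0 : s 0%N = rpoch 0%N.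
    by rewrite /s /cprod big_ord1 /g /dpoch /spread /rpoch /= !qprod0 expr0 invr1 !mulr1.
  split=> //; apply: (mulfI (q_nunity 0)); rewrite sS rpochS /= s0.
  by rewrite expr0 add0r mul1r.
split=> //; apply: (mulfI (q_nunity n.+1)); rewrite sS /= IH1 IH2 rpochS /=.
have := rpochS n.+1 => /= <-; ring.
Qed.

Lemma rpoch_ccoef n : rpoch n = ccoef n + delay ccoef2 n.
Proof.
rewrite -rpoch_cprod -cprod_delayl -cprodDl; apply: eq_cprod => // i.
rewrite -acoefD mulrDr; case: i => [|i] //=; first by rewrite mulr0.
by congr (_ + _); rewrite binS2 exprD /hcoef; ring.
Qed.

(** * A finite form of Jacobi's two-squares identity *)

(** [(- q; q)_n / (q; q)_n] *)
Definition cratio n := qprod (- q) q n / qprod q q n.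

Lemma qprodNE n : qprod (- q) q n.+1 = qprod (- q) q n * (1 + q ^+ n.+1).
Proof. by rewrite qprodS mulNr -exprS opprK. Qed.

Lemma cratioS n : cratio n.+1 = cratio n * ((1 + q ^+ n.+1) / (1 - q ^+ n.+1)).
Proof.
rewrite /cratio qprodNE qprodS -exprS invfM; ring.
Qed.

Lemma q_nunityD n : 1 + q ^+ n.+1 != 0.
Proof.
apply/eqP => h; have /negP[] := q_nunity (n.+1 + n).
apply/eqP; have -> : ((n.+1 + n).+1 = n.+1 * 2)%N by lia.
by rewrite exprM -[RHS](mul0r (1 - q ^+ n.+1)) -h; ring.
Qed.

(** The summand of index [n = k + 1] in the finite identity. *)
Definition tsq_term N k : F :=
  (- q) ^+ k.+1 / (1 + p ^+ k.+1) * (cratio (N + k.+1) * cratio (N - k.+1)).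

(** Pairing [n] with [- n], this says that, with [r_m = cratio m],
    [sum_(- N <= n <= N) 2 (- q)^n / (1 + q^(2n)) r_(N+n) r_(N-n) = 1]. *)
Lemma two_squares_fin N :
  cratio N ^+ 2 + 4 * (\sum_(k < N) tsq_term N k) = 1.
Proof.
elim: N => [|N IH].
  by rewrite big_ord0 mulr0 addr0 /cratio !qprod0 divr1 expr1n.
pose kap := q ^+ N.+1 / (1 - q ^+ (2 * N.+1)).
(* the increments in N of the summands are differences of G *)
pose G n := (-1) ^+ n * (cratio (N + n) * cratio (N.+1 - n)).
have nz2 : 1 - q ^+ (2 * N.+1) != 0 by rewrite mulnS; exact: q_nunity.
have step k : (k < N)%N ->
    tsq_term N.+1 k - tsq_term N k = kap * (G k.+1 - G k.+2).
  move=> kN; have [j eN] : exists j, N = (j + k.+1)%N.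
    by exists (N - k.+1)%N; rewrite subnK.
  have e1 : ((j + k.+1).+1 - k.+1 = j.+1)%N by lia.
  have e2 : ((j + k.+1).+1 - k.+2 = j)%N by lia.
  rewrite /tsq_term /G /kap eN e1 e2 addnK addSn (addnS _ k.+1).
  have A := q_nunityD (2 * k).+1; have B := q_nunity j.
  have C := q_nunity (j + k.+1 + k.+1).
  have D : 1 - q ^+ (2 * (j + k.+1).+1) != 0 by rewrite mulnS; exact: q_nunity.
  move: D C A; rewrite !cratioS.
  have -> : (2 * (j + k.+1).+1 = j.+1 * 2 + k.+1 * 2)%N by lia.
  have -> : ((j + k.+1 + k.+1).+1 = j.+1 + k.+1 * 2)%N by lia.
  have -> : ((2 * k).+2 = k.+1 * 2)%N by lia.
  have -> : ((j + k.+1).+1 = j.+1 + k.+1)%N by lia.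
  rewrite -[q ^+ 2 ^+ k.+1]exprM [(2 * k.+1)%N]mulnC !exprD !exprM.
  rewrite -[- q]mulN1r !exprMn.
  rewrite (exprS _ k.+1).
  move: B; set B := q ^+ j.+1; set t := q ^+ k.+1; set c := cratio _.
  set c' := cratio _; set s := (-1) ^+ k.+1 => hB hD hC hA.
  by field; rewrite exprMn hA hB hC hD.
rewrite -[RHS]IH big_ord_recr /= mulrDr.
have -> : \sum_(k < N) tsq_term N.+1 k =
    \sum_(k < N) tsq_term N k - kap * (G N.+1 - G 1%N).
  have -> : G N.+1 - G 1%N = \sum_(k < N) (G k.+2 - G k.+1).
    rewrite -(telescope_sumr (fun k => G k.+1) (leq0n N)).
    by rewrite big_mkord.
  rewrite mulr_sumr -sumrB; apply: eq_bigr => k _.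
  by rewrite -[tsq_term N.+1 k](subrK (tsq_term N k)) step //; ring.
rewrite /G /kap /tsq_term !subSS subn0 !subnn addn1 addnS cratioS.
have -> : (N.+1 + N.+1 = (N + N).+2)%N by lia.
have h1 := q_nunity N; have h3 := q_nunity (N + N).
have h4 := q_nunityD (N + N).+1; move: nz2 h4.
rewrite -[q ^+ 2 ^+ N.+1]exprM !cratioS.
have -> : ((N + N).+2 = N.+1 * 2)%N by lia.
move: (cratio N) => c; rewrite (mulnC 2%N) exprM -[- q]mulN1r !exprMn expr1.
move: h1 h3; set u := q ^+ N.+1; set v := q ^+ (N + N).+1.
move=> h1 h3 h2 h4.
set S := \sum_(k < N) _.
by field; rewrite h1 h2 h3 h4.
Qed.

End Algebra.

(** * Limits and series in R[i] *)

Section Limits.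
Variable R : realType.
Local Notation C := R[i].
Local Open Scope classical_set_scope.
Implicit Types (u v : nat -> C) (l z Q B : C).

Lemma cvg_seqP u l : u @ \oo --> l <->
  forall e : C, 0 < e -> exists N, forall n, (N <= n)%N -> `|l - u n| < e.
Proof.
split=> [/cvgrPdist_lt h e e0|h].
  by have [N _ hN] := h e e0; exists N => n Nn; apply: hN.
apply/cvgrPdist_lt => e e0; have [N hN] := h e e0.
by exists N => // n; exact: hN.
Qed.

Lemma cvg_seq_unique u l l' : u @ \oo --> l -> u @ \oo --> l' -> l = l'.
Proof. by move=> h h'; apply: (cvg_unique _ h h'). Qed.

Lemma eq_cvg_seq u v l : u =1 v -> v @ \oo --> l -> u @ \oo --> l.
Proof. by move=> /funext ->. Qed.

Lemma cvg_seq_lim u l : u @ \oo --> l -> limn u = l.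
Proof. by move=> h; apply: (cvg_lim _ h). Qed.

Lemma expr_cvg0 z : `|z| < 1 -> (fun n => z ^+ n) @ \oo --> (0 : C).
Proof.
move=> z1; apply/cvg_seqP => e e0.
have er : e = (complex.Re e)%:C%C by rewrite RRe_real // gtr0_real.
have [r zr] : exists r : R, `|z| = r%:C%C.
  by exists (complex.Re `|z|); rewrite RRe_real // normr_real.
have r0 : 0 <= r by rewrite -lecR -zr; exact: normr_ge0.
have r1 : `|r| < 1 by rewrite ger0_norm // -ltcR -zr; exact: z1.
have /cvgrPdist_lt /(_ (complex.Re e)) [|N _ hN] := cvg_expr r1.
  by rewrite -ltcR -er; exact: e0.
exists N => n /hN /=; rewrite !sub0r !normrN !normrX -ltcR -er zr.
by rewrite ger0_norm // rmorphXn.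
Qed.

Lemma cvg_geo_dist u l B Q : 0 <= Q -> Q < 1 ->
  (forall n, `|l - u n| <= B * Q ^+ n) -> u @ \oo --> l.
Proof.
move=> Q0 Q1 h; apply/cvg_seqP => e e0.
have B0 : 0 <= B by have := le_trans (normr_ge0 _) (h 0%N); rewrite mulr1.
have Qn : `|Q| < 1 by rewrite ger0_norm.
have /cvg_seqP /(_ (e / (B + 1))) [|N hN] := expr_cvg0 Qn.
  by rewrite divr_gt0 // ltr_wpDl.
exists N => n /hN; rewrite sub0r normrN normrX (ger0_norm Q0) => hn.
apply: (le_lt_trans (h n)); move: hn; rewrite ltr_pdivlMr ?ltr_wpDl //.
by apply: le_lt_trans; rewrite mulrC ler_wpM2l ?exprn_ge0 // lerDl.
Qed.

Lemma geo_sum_le B Q m n : 0 <= B -> 0 <= Q -> Q < 1 ->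
  \sum_(k < n) B * Q ^+ (m + k) <= B * Q ^+ m / (1 - Q).
Proof.
move=> B0 Q0 Q1; have Q2 : 0 < 1 - Q by rewrite subr_gt0.
rewrite ler_pdivlMr // -subr_ge0.
suff -> : B * Q ^+ m - (\sum_(k < n) B * Q ^+ (m + k)) * (1 - Q) = B * Q ^+ (m + n).
  by rewrite mulr_ge0 // exprn_ge0.
elim: n => [|n IH]; first by rewrite big_ord0 addn0 mul0r subr0.
by rewrite big_ord_recr /= mulrDl opprD addrA IH addnS exprS; ring.
Qed.

Lemma norm_imag : `|'i%C : C| = 1.
Proof. by rewrite normc_def /= expr0n expr1n add0r sqrtr1. Qed.

Lemma geo_summable_real (u : nat -> R) (B Q : R) : 0 <= Q -> Q < 1 ->
  (forall n, `|u n| <= B * Q ^+ n) -> cvgn (fun n => \sum_(k < n) u k).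
Proof.
move=> Q0 Q1 h.
have -> : (fun n => \sum_(k < n) u k) = series u.
  by apply/funext => n; rewrite /series /= big_mkord.
apply: normed_cvg; apply: (series_le_cvg _ _ h) => [n|n|].
- exact: normr_ge0.
- exact: le_trans (h n).
- by apply: is_cvg_geometric_series; rewrite ger0_norm.
Qed.

(** Absolute convergence by comparison with a geometric series; completeness is
    used through the real and imaginary parts. *)
Lemma geo_summable u B Q : 0 <= Q -> Q < 1 -> (forall n, `|u n| <= B * Q ^+ n) ->
  exists l, (fun n => \sum_(k < n) u k) @ \oo --> l.
Proof.
move=> Q0 Q1 h.
have B0 : 0 <= B by have := le_trans (normr_ge0 _) (h 0%N); rewrite mulr1.
have Br : B = (complex.Re B)%:C%C by rewrite RRe_real // ger0_real.
have Qr : Q = (complex.Re Q)%:C%C by rewrite RRe_real // ger0_real.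
have Q0' : 0 <= complex.Re Q by rewrite -lecR -Qr; exact: Q0.
have Q1' : complex.Re Q < 1 by rewrite -ltcR -Qr; exact: Q1.
have hr n : `|complex.Re (u n)| <= complex.Re B * complex.Re Q ^+ n.
  rewrite -lecR rmorphM rmorphXn /= -Br -Qr.
  exact: le_trans (normc_ge_Re _) (h n).
have hi n : `|complex.Im (u n)| <= complex.Re B * complex.Re Q ^+ n.
  have := normc_ge_Re (u n * - 'i%C); rewrite normrM normrN norm_imag mulr1.
  have -> : complex.Re (u n * - 'i%C) = complex.Im (u n).
    by case: (u n) => x y /=; ring.
  move=> hle; rewrite -lecR rmorphM rmorphXn /= -Br -Qr.
  exact: le_trans hle (h n).
have /cvg_ex [a /cvgrPdist_lt ha] := geo_summable_real Q0' Q1' hr.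
have /cvg_ex [b /cvgrPdist_lt hb] := geo_summable_real Q0' Q1' hi.
exists (a +i* b)%C; apply/cvg_seqP => e e0.
have er : e = (complex.Re e)%:C%C by rewrite RRe_real // gtr0_real.
have e2 : 0 < complex.Re e / 2 by rewrite divr_gt0 // -ltcR -er; exact: e0.
have [N1 _ hN1] := ha _ e2; have [N2 _ hN2] := hb _ e2.
exists (maxn N1 N2) => n; rewrite geq_max => /andP[/hN1 + /hN2] /=.
set s := \sum_(k < n) u k.
have -> : \sum_(k < n) complex.Re (u k) = complex.Re s.
  by rewrite raddf_sum.
have -> : \sum_(k < n) complex.Im (u k) = complex.Im s.
  by rewrite raddf_sum.
move=> h1 h2.
have -> : (a +i* b)%C - s = (a - complex.Re s)%:C%C + 'i%C * (b - complex.Im s)%:C%C.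
  case: (s) => x y; apply/eqP; rewrite eq_complex /=.
  by apply/andP; split; apply/eqP; ring.
apply: le_lt_trans (ler_normD _ _) _.
rewrite normrM norm_imag mul1r !normc_def /= !expr0n /= !addr0 !sqrtr_sqr er -rmorphD ltcR.
lra.
Qed.

Lemma lim_norm_le u l B : u @ \oo --> l -> (forall n, `|u n| <= B) -> `|l| <= B.
Proof.
move=> /cvg_seqP h uB; apply/ler_addgt0Pl => e /h [N /(_ N (leqnn N)) hN].
have -> : l = (l - u N) + u N by rewrite subrK.
exact: (le_trans (ler_normD _ _) (lerD (ltW hN) (uB N))).
Qed.

Lemma geo_sum_norm_le u l B Q : 0 <= Q -> Q < 1 -> (forall n, `|u n| <= B * Q ^+ n) ->
  (fun n => \sum_(k < n) u k) @ \oo --> l -> `|l| <= B / (1 - Q).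
Proof.
move=> Q0 Q1 h ul; apply: (lim_norm_le ul) => n.
have B0 : 0 <= B by have := le_trans (normr_ge0 _) (h 0%N); rewrite mulr1.
apply: le_trans (ler_norm_sum _ _ _) _.
have hk (k : 'I_n) : true -> `|u k| <= B * Q ^+ (0 + k) by move=> _; exact: h.
apply: le_trans (ler_sum _ hk) _.
by have := geo_sum_le 0 n B0 Q0 Q1; rewrite expr0 mulr1.
Qed.

Lemma lim_sum (f : nat -> nat -> C) (u : nat -> C) m :
  (forall k, (fun n => f n k) @ \oo --> u k) ->
  (fun n => \sum_(k < m) f n k) @ \oo --> \sum_(k < m) u k.
Proof.
move=> h; elim: m => [|m IH].
  rewrite big_ord0; apply/cvg_seqP => e e0; exists 0%N => n _.
  by rewrite big_ord0 subrr normr0.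
rewrite big_ord_recr /=.
have -> : (fun n => \sum_(k < m.+1) f n k) = (fun n => \sum_(k < m) f n k + f n m).
  by apply/funext => n; rewrite big_ord_recr.
exact: (cvgD IH (h m)).
Qed.

Lemma sum_ord_split (g : nat -> C) m n : (m <= n)%N ->
  \sum_(k < n) g k = \sum_(k < m) g k + \sum_(k < n - m) g (m + k)%N.
Proof. by move=> mn; rewrite -[in LHS](subnKC mn) big_split_ord. Qed.

(** Tannery's theorem: dominated convergence for series. *)
Lemma tannery (f : nat -> nat -> C) u l B Q : 0 <= Q -> Q < 1 ->
  (forall n k, (k < n)%N -> `|f n k| <= B * Q ^+ k) ->
  (forall k, (fun n => f n k) @ \oo --> u k) ->
  (fun n => \sum_(k < n) u k) @ \oo --> l ->
  (fun n => \sum_(k < n) f n k) @ \oo --> l.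
Proof.
move=> Q0 Q1 fB fu /cvg_seqP ul; apply/cvg_seqP => e e0.
have B0 : 0 <= B by have := le_trans (normr_ge0 _) (fB 1%N 0%N isT); rewrite mulr1.
have Q2 : 0 < 1 - Q by rewrite subr_gt0.
have e3 : 0 < e / 3 by rewrite divr_gt0.
have [N1 hN1] := ul _ e3.
have Qn : `|Q| < 1 by rewrite ger0_norm.
have /cvg_seqP /(_ (e / 3 / (B / (1 - Q) + 1))) [|N2 hN2] := expr_cvg0 Qn.
  by rewrite divr_gt0 // ltr_wpDl // divr_ge0 // ltW.
pose m := maxn N1 N2.
have /cvg_seqP /(_ _ e3) [N3 hN3] := @lim_sum f u m fu.
exists (maxn m N3) => n; rewrite geq_max => /andP[mn N3n].
have -> : l - \sum_(k < n) f n k = (l - \sum_(k < m) u k)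
   + (\sum_(k < m) u k - \sum_(k < m) f n k) - \sum_(k < n - m) f n (m + k)%N.
  rewrite (sum_ord_split (f n) mn); ring.
have -> : e = e / 3 + e / 3 + e / 3 by field.
apply: le_lt_trans (ler_normB _ _) _; apply: ltrD.
  apply: le_lt_trans (ler_normD _ _) _; apply: ltrD.
    by apply: hN1; rewrite leq_maxl.
  exact: hN3.
have := hN2 m (leq_maxr _ _); rewrite sub0r normrN normrX (ger0_norm Q0) => h.
apply: le_lt_trans (ler_norm_sum _ _ _) _.
have hk (k : 'I_(n - m)) : true -> `|f n (m + k)%N| <= B * Q ^+ (m + k).
  by move=> _; apply: fB; have := ltn_ord k; lia.
apply: le_lt_trans (ler_sum _ hk) _.
apply: le_lt_trans (geo_sum_le _ _ B0 Q0 Q1) _.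
move: h; rewrite ltr_pdivlMr; last by rewrite ltr_wpDl // divr_ge0 // ltW.
apply: le_lt_trans; rewrite mulrDr mulr1 mulrAC mulrC lerDl.
by rewrite exprn_ge0.
Qed.

End Limits.

(** * Bounds and limits of q-Pochhammer symbols *)

Section PochhammerBounds.
Variable R : realType.
Local Notation C := R[i].
Local Open Scope classical_set_scope.
Implicit Types (a q Q : C).

Lemma one_sub_expr_gt0 Q n : 0 <= Q -> Q < 1 -> 0 < 1 - Q ^+ n.+1.
Proof. by move=> Q0 Q1; rewrite subr_gt0 exprn_ilt1. Qed.

Lemma qprod_gt0 Q n : 0 <= Q -> Q < 1 -> 0 < qprod Q Q n.
Proof.
by move=> Q0 Q1; apply: prodr_gt0 => k _; rewrite -exprS one_sub_expr_gt0.
Qed.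

Lemma qprod_decr Q m n : 0 <= Q -> Q < 1 -> qprod Q Q (m + n) <= qprod Q Q m.
Proof.
move=> Q0 Q1; elim: n => [|n IH]; first by rewrite addn0.
rewrite addnS qprodS -exprS; apply: le_trans IH.
by rewrite ler_piMr ?(ltW (qprod_gt0 _ _ _)) // gerBl exprn_ge0.
Qed.

Lemma qprod_lower_bound Q : 0 <= Q -> Q < 1 ->
  exists2 b : C, 0 < b & forall n, b <= qprod Q Q n.
Proof.
move=> Q0 Q1; have Q2 : 0 < 1 - Q by rewrite subr_gt0.
have Qn : `|Q| < 1 by rewrite ger0_norm.
have /cvg_seqP /(_ ((1 - Q) / 2)) [|m hm] := expr_cvg0 Qn.
  by rewrite divr_gt0.
pose t := Q ^+ m.+1 / (1 - Q).
have tE : Q ^+ m.+1 = t * (1 - Q) by rewrite mulfVK // gt_eqF.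
have t0 : 0 <= t by rewrite divr_ge0 ?exprn_ge0 // ltW.
have t2 : t <= 1 / 2.
  rewrite ler_pdivrMr // mulrC mulrA mulr1; apply: ltW.
  by have := hm m.+1 (leqnSn _); rewrite sub0r normrN normrX (ger0_norm Q0).
(* the factors beyond the first m lose at most sum_(k > m) Q^k <= 1/2 *)
have h n : qprod Q Q m * (1 - t * (1 - Q ^+ n)) <= qprod Q Q (m + n).
  elim: n => [|n IH]; first by rewrite addn0 expr0 subrr mulr0 subr0 mulr1.
  rewrite addnS qprodS -exprS -addSn exprD tE.
  rewrite -subr_ge0.
  have -> : qprod Q Q (m + n) * (1 - t * (1 - Q) * Q ^+ n)
     - qprod Q Q m * (1 - t * (1 - Q ^+ n.+1)) =
    (qprod Q Q (m + n) - qprod Q Q m * (1 - t * (1 - Q ^+ n))) +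
    t * (1 - Q) * Q ^+ n * (qprod Q Q m - qprod Q Q (m + n)).
    by rewrite exprS; ring.
  apply: addr_ge0; first by rewrite subr_ge0.
  rewrite mulr_ge0 ?subr_ge0 ?qprod_decr // mulr_ge0 ?exprn_ge0 //.
  by rewrite mulr_ge0 // ltW.
exists (qprod Q Q m * (1 / 2)); first by rewrite mulr_gt0 ?qprod_gt0 ?divr_gt0.
move=> n; have h1 : qprod Q Q (m + n) <= qprod Q Q n by rewrite addnC qprod_decr.
apply: le_trans h1; apply: le_trans (h n); rewrite ler_pM2l ?qprod_gt0 //.
have -> : (1 / 2 : C) = 1 - 1 / 2 by field.
rewrite lerD2l lerN2; apply: le_trans t2; rewrite ler_piMr // gerBl.
exact: exprn_ge0.
Qed.

Lemma norm_qprod_ge a q n : `|a| = `|q| -> `|q| < 1 ->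
  qprod `|q| `|q| n <= `|qprod a q n|.
Proof.
move=> aq q1; elim: n => [|n IH]; first by rewrite !qprod0 normr1.
rewrite !qprodS normrM -exprS.
rewrite ler_pM ?(ltW (qprod_gt0 _ _ _)) ?(ltW (one_sub_expr_gt0 _ _ _)) //.
apply: le_trans (lerB_dist _ _); by rewrite normr1 normrM normrX aq exprS.
Qed.


Lemma norm_qprod_le a q n : `|a| = `|q| -> `|q| < 1 ->
  `|qprod a q n| <= (qprod `|q| `|q| n)^-1.
Proof.
move=> aq q1; elim: n => [|n IH]; first by rewrite !qprod0 normr1 invr1.
rewrite !qprodS normrM invfM ler_pM // -exprS.
apply: le_trans (ler_normB _ _) _; rewrite normr1 normrM normrX aq -exprS.
rewrite -[leRHS]mul1r ler_pdivlMr ?one_sub_expr_gt0 //.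
rewrite -subr_ge0; set x := _ ^+ n.+1.
have -> : 1 - (1 + x) * (1 - x) = x ^+ 2 by ring.
by rewrite !exprn_ge0.
Qed.

Lemma one_sub_expr_neq0 q : `|q| < 1 -> forall n, 1 - q ^+ n.+1 != 0.
Proof.
move=> q1 n; rewrite subr_eq0 eq_sym; apply/eqP => h.
have : `|q ^+ n.+1| < 1 by rewrite normrX exprn_ilt1.
by rewrite h normr1 ltxx.
Qed.

Lemma norm_expr2_lt1 q : `|q| < 1 -> `|q ^+ 2| < 1.
Proof. by move=> q1; rewrite normrX exprn_ilt1. Qed.

Lemma qprod_bounded a q : `|a| = `|q| -> `|q| < 1 ->
  exists2 B : C, 0 < B &
    forall n, `|qprod a q n| <= B /\ `|(qprod a q n)^-1| <= B.
Proof.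
move=> aq q1; have [b b0 hb] := qprod_lower_bound (normr_ge0 q) q1.
exists b^-1; first by rewrite invr_gt0.
move=> n; split.
  apply: le_trans (norm_qprod_le n aq q1) _.
  by rewrite lef_pV2 ?posrE ?qprod_gt0.
rewrite normfV lef_pV2 ?posrE //.
  exact: le_trans (hb n) (norm_qprod_ge n aq q1).
exact: lt_le_trans (qprod_gt0 n (normr_ge0 q) q1) (norm_qprod_ge n aq q1).
Qed.

Lemma qprod_cvg a q : `|a| = `|q| -> `|q| < 1 ->
  exists2 l : C, l != 0 & qprod a q @ \oo --> l.
Proof.
move=> aq q1; have [B B0 hB] := qprod_bounded aq q1.
have [b b0 hb] := qprod_lower_bound (normr_ge0 q) q1.
have step n : `|qprod a q n.+1 - qprod a q n| <= B * `|q| ^+ n.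
  have -> : qprod a q n.+1 - qprod a q n = - (qprod a q n * (a * q ^+ n)).
    by rewrite qprodS; ring.
  rewrite normrN !normrM normrX ler_pM ?mulr_ge0 ?exprn_ge0 ?(hB n).1 //.
  by rewrite ler_piMl ?exprn_ge0 // aq ltW.
have [l hl] := geo_summable (normr_ge0 q) q1 step.
have h1 : qprod a q @ \oo --> 1 + l.
  have -> : qprod a q = fun n => 1 + \sum_(k < n) (qprod a q k.+1 - qprod a q k).
    apply/funext; elim=> [|n IH]; first by rewrite big_ord0 addr0 qprod0.
    by rewrite big_ord_recr /= addrA -IH addrC subrK.
  exact: (cvgD (cvg_cst _) hl).
exists (1 + l) => //; apply/eqP => l0.
have /cvg_seqP /(_ b b0) [N /(_ N (leqnn N))] := h1.
rewrite l0 sub0r normrN => /(le_lt_trans (norm_qprod_ge N aq q1)).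
by move=> /(le_lt_trans (hb N)); rewrite ltxx.
Qed.

End PochhammerBounds.

(** * Series with theta-like weights *)

Section ThetaSums.
Variables (R : realType) (q : R[i]).
Hypothesis q1 : `|q| < 1.
Local Notation C := R[i].
Local Open Scope classical_set_scope.
Implicit Types (u v : nat -> C) (x : C).

Definition bounded_seq u := exists B : C, forall n, `|u n| <= B.

(** The sum of [q^C(k+1,2) x^k u_k]; it is used for [u] bounded and [|x| <= 1]. *)
Definition thsum u x : C :=
  limn (fun n => \sum_(k < n) q ^+ 'C(k.+1, 2) * x ^+ k * u k).

Lemma leq_bin2 k : (k <= 'C(k.+1, 2))%N.
Proof. by rewrite binS2 leq_addl. Qed.

Lemma thsum_term_le u x B k : `|x| <= 1 -> `|u k| <= B ->
  `|q ^+ 'C(k.+1, 2) * x ^+ k * u k| <= B * `|q| ^+ k.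
Proof.
move=> x1 uB; rewrite !normrM !normrX mulrC ler_pM ?mulr_ge0 ?exprn_ge0 //.
rewrite -[leRHS]mulr1 ler_pM ?exprn_ge0 ?exprn_ile1 //.
by rewrite ler_wiXn2l // ?leq_bin2 // ltW.
Qed.

Lemma thsum_cvg u x : `|x| <= 1 -> bounded_seq u ->
  (fun n => \sum_(k < n) q ^+ 'C(k.+1, 2) * x ^+ k * u k) @ \oo --> thsum u x.
Proof.
move=> x1 [B uB].
have [l hl] := geo_summable (normr_ge0 q) q1 (fun k => thsum_term_le x1 (uB k)).
by rewrite /thsum (cvg_seq_lim hl).
Qed.

Lemma thsum_le u x B : `|x| <= 1 -> (forall n, `|u n| <= B) ->
  `|thsum u x| <= B / (1 - `|q|).
Proof.
move=> x1 uB; apply: (geo_sum_norm_le (normr_ge0 q) q1 (fun k => thsum_term_le x1 (uB k))).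
by apply: thsum_cvg => //; exists B.
Qed.

Lemma eq_thsum u v x : u =1 v -> thsum u x = thsum v x.
Proof. by move=> /funext ->. Qed.

Lemma thsumD u v x : `|x| <= 1 -> bounded_seq u -> bounded_seq v ->
  thsum (fun n => u n + v n) x = thsum u x + thsum v x.
Proof.
move=> x1 bu bv; apply: cvg_seq_lim.
have -> : (fun n => \sum_(k < n) q ^+ 'C(k.+1, 2) * x ^+ k * (u k + v k)) =
  fun n => (\sum_(k < n) q ^+ 'C(k.+1, 2) * x ^+ k * u k) +
   \sum_(k < n) q ^+ 'C(k.+1, 2) * x ^+ k * v k.
  by apply/funext => n; rewrite -big_split /=; apply: eq_bigr => k _; rewrite mulrDr.
exact: (cvgD (thsum_cvg x1 bu) (thsum_cvg x1 bv)).
Qed.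

Lemma thsum_expr u x : thsum (fun n => q ^+ n * u n) x = thsum u (x * q).
Proof.
congr (limn _); apply/funext => n; apply: eq_bigr => k _.
by rewrite exprMn; ring.
Qed.

Lemma mul_q_le1 x : `|x| <= 1 -> `|x * q| <= 1.
Proof. by move=> x1; rewrite normrM mulr_ile1 // ltW. Qed.

Lemma thsum_recl u x : `|x| <= 1 -> bounded_seq u ->
  thsum u x = u 0%N + x * q * thsum (fun n => u n.+1) (x * q).
Proof.
move=> x1 bu; apply: cvg_seq_lim; rewrite -cvg_shiftS /=.
have -> : (fun n => \sum_(k < n.+1) q ^+ 'C(k.+1, 2) * x ^+ k * u k) =
  fun n => u 0%N + (x * q) * (\sum_(k < n) q ^+ 'C(k.+1, 2) * (x * q) ^+ k * u k.+1).
  apply/funext => n; rewrite big_ord_recl /= !expr0 !mul1r mulr_sumr.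
  congr (_ + _); apply: eq_bigr => k _; rewrite /= /bump /= add1n.
  by rewrite [in LHS]binS2 exprD !exprMn !exprS; ring.
apply: (cvgD (cvg_cst _)); apply: cvgM; first exact: cvg_cst.
apply: thsum_cvg; first exact: mul_q_le1.
by case: bu => B hB; exists B => n.
Qed.

Lemma thsum_delay u x : `|x| <= 1 -> bounded_seq u ->
  thsum (delay u) x = x * q * thsum u (x * q).
Proof.
move=> x1 [B hB]; rewrite thsum_recl //= ?add0r //.
exists B => -[|n] //=; rewrite normr0; exact: le_trans (normr_ge0 _) (hB 0%N).
Qed.

End ThetaSums.

(** * Majorants of the coefficients *)

Section Majorants.
Variables (R : realType) (q : R[i]).
Hypothesis q1 : `|q| < 1.
Local Notation C := R[i].
Local Open Scope classical_set_scope.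
Local Notation Q := (`|q|).

Lemma norm_cprod_le (f g F G : nat -> C) :
  (forall n, `|f n| <= F n) -> (forall n, `|g n| <= G n) ->
  forall n, `|cprod f g n| <= cprod F G n.
Proof.
move=> fF gG n; apply: le_trans (ler_norm_sum _ _ _) _.
by apply: ler_sum => i _; rewrite normrM ler_pM.
Qed.

Lemma norm_rpoch_le n : `|rpoch q n| <= rpoch Q n.
Proof.
rewrite normfV lef_pV2 ?posrE ?qprod_gt0 //; first exact: norm_qprod_ge.
exact: lt_le_trans (qprod_gt0 n (normr_ge0 q) q1) (norm_qprod_ge n _ q1).
Qed.

Lemma norm_qprod2V_le n :
  `|(qprod (q ^+ 2) (q ^+ 2) n)^-1| <= (qprod (Q ^+ 2) (Q ^+ 2) n)^-1.
Proof.
have q2 := norm_expr2_lt1 q1; have h := norm_qprod_ge n (erefl `|q ^+ 2|) q2.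
have h0 := qprod_gt0 n (normr_ge0 (q ^+ 2)) q2.
by rewrite -normrX normfV lef_pV2 ?posrE //; apply: lt_le_trans h.
Qed.

Lemma norm_dpoch_le n : `|dpoch q n| <= dpoch Q n.
Proof.
rewrite /dpoch /spread; case: (odd n); first by rewrite normr0.
exact: norm_qprod2V_le.
Qed.

Lemma norm_ecoef_le n : `|ecoef q n| <= ecoef Q n.
Proof. by rewrite normrM normrX ler_pM ?exprn_ge0 ?norm_rpoch_le. Qed.

Lemma norm_acoef_le n : `|acoef q n| <= acoef Q n.
Proof. exact: norm_cprod_le norm_ecoef_le norm_dpoch_le _. Qed.

Lemma norm_hcoef_le n : `|hcoef q n| <= hcoef Q n.
Proof. by rewrite normrM normrX ler_pM ?exprn_ge0 ?norm_acoef_le. Qed.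

Lemma norm_ccoef_le n : `|ccoef q n| <= ccoef Q n.
Proof. exact: norm_cprod_le norm_hcoef_le norm_dpoch_le _. Qed.

Lemma norm_ccoef2_le n : `|ccoef2 q n| <= ccoef2 Q n.
Proof.
apply: norm_cprod_le norm_dpoch_le _ => k.
by rewrite normrM normrX ler_pM ?exprn_ge0 ?norm_hcoef_le.
Qed.

Let Q1 : `|Q| < 1. Proof. by rewrite normr_id. Qed.

(** For the nonnegative base [|q|], both terms of [rpoch_ccoef] are nonnegative,
    so that each is bounded by their sum. *)
Lemma ccoef_le n : ccoef Q n <= rpoch Q n.
Proof.
rewrite (rpoch_ccoef (one_sub_expr_neq0 Q1)) lerDl; case: n => [|n] //=.
exact: le_trans (norm_ccoef2_le n).
Qed.

Lemma ccoef2_le n : ccoef2 Q n <= rpoch Q n.+1.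
Proof.
rewrite (rpoch_ccoef (one_sub_expr_neq0 Q1)) lerDr.
exact: le_trans (norm_ccoef_le n.+1).
Qed.

Lemma rpoch_bounded : exists B : C, forall n, rpoch Q n <= B.
Proof.
have [b b0 hb] := qprod_lower_bound (normr_ge0 q) q1.
by exists b^-1 => n; rewrite lef_pV2 ?posrE ?qprod_gt0.
Qed.

Lemma bounded_rpoch : bounded_seq (rpoch q).
Proof.
have [B hB] := rpoch_bounded; exists B => n.
exact: le_trans (norm_rpoch_le n) (hB n).
Qed.

Lemma bounded_ccoef : bounded_seq (ccoef q).
Proof.
have [B hB] := rpoch_bounded; exists B => n.
exact: le_trans (le_trans (norm_ccoef_le n) (ccoef_le n)) (hB n).
Qed.

Lemma bounded_ccoef2 : bounded_seq (ccoef2 q).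
Proof.
have [B hB] := rpoch_bounded; exists B => n.
exact: le_trans (le_trans (norm_ccoef2_le n) (ccoef2_le n)) (hB n.+1).
Qed.

Lemma bounded_delay (u : nat -> C) : bounded_seq u -> bounded_seq (delay u).
Proof.
move=> [B hB]; exists B => -[|n] //=.
by rewrite normr0; exact: le_trans (normr_ge0 _) (hB 0%N).
Qed.

Lemma bounded_expr (u : nat -> C) : bounded_seq u -> bounded_seq (fun n => q ^+ n * u n).
Proof.
move=> [B hB]; exists B => n; rewrite normrM normrX -[leRHS]mul1r.
by rewrite ler_pM ?exprn_ge0 // exprn_ile1 // ltW.
Qed.

End Majorants.

(** * The functional equations *)

Section FunctionalEquations.
Variables (R : realType) (q : R[i]).
Hypothesis q1 : `|q| < 1.
Local Notation C := R[i].
Local Open Scope classical_set_scope.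
Implicit Types (x : C).
Local Notation p := (q ^+ 2).

(** The theta-weighted series [E] with coefficients [1 / (q; q)_n], and [W] with
    the coefficients [ccoef2] delayed by one. *)
Definition Esum x := thsum q (rpoch q) x.
Definition Wsum x := thsum q (delay (ccoef2 q)) x.
Let nq := one_sub_expr_neq0 q1.

Lemma Esum_eq x : `|x| <= 1 -> Esum x = (1 + x * q) * Esum (x * q).
Proof.
move=> x1; have br := bounded_rpoch q1; rewrite /Esum.
rewrite (eq_thsum q x (v := fun n => delay (rpoch q) n + q ^+ n * rpoch q n)).
  rewrite thsumD // ?thsum_delay ?thsum_expr //; last exact: bounded_expr.
    by ring.
  exact: bounded_delay.
by move=> n; rewrite -rpochS //; ring.
Qed.

Lemma Wsum_eq x : `|x| <= 1 ->
  Wsum x = x * q * (Esum (x * p) - (1 - x * p) * Wsum (x * p)).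
Proof.
move=> x1; have b2 := bounded_ccoef2 q1; have bc := bounded_ccoef q1.
have bd := bounded_delay b2.
have x2 := mul_q_le1 q1 x1; have x3 := mul_q_le1 q1 x2.
have xp : x * p = x * q * q by rewrite expr2 mulrA.
have EcW : Esum (x * p) = thsum q (ccoef q) (x * p) + Wsum (x * p).
  rewrite xp /Esum /Wsum -thsumD //; apply: eq_thsum => n.
  exact: rpoch_ccoef.
rewrite {1}/Wsum thsum_delay //; congr (_ * _).
have -> : thsum q (ccoef2 q) (x * q) = thsum q
    (fun n => delay (delay (ccoef2 q)) n + q ^+ n * ccoef q n) (x * q).
  by apply: eq_thsum => n; rewrite -ccoef2B //; ring.
rewrite thsumD //; [|exact: bounded_delay|exact: bounded_expr].
rewrite thsum_delay // thsum_expr -/(Wsum _) EcW -xp xp; ring.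
Qed.

(** [(- p; p)_n] *)
Definition mpoch n := qprod (- p) p n.

Lemma mpochS n : mpoch n.+1 = mpoch n * (1 + p ^+ n.+1).
Proof. exact: qprodNE. Qed.

Lemma mpoch_bounded : exists2 B : C, 0 < B &
  forall n, `|mpoch n| <= B /\ `|(mpoch n)^-1| <= B.
Proof. by apply: qprod_bounded; rewrite ?normrN ?norm_expr2_lt1. Qed.

Lemma one_add_p_neq0 n : 1 + p ^+ n.+1 != 0.
Proof. exact: q_nunityD (one_sub_expr_neq0 (norm_expr2_lt1 q1)) n. Qed.

Lemma mpoch_neq0 n : mpoch n != 0.
Proof.
elim: n => [|n IH]; first by rewrite /mpoch qprod0 oner_neq0.
by rewrite mpochS mulf_neq0 ?one_add_p_neq0.
Qed.

(** The terms of the series [F_s]. At [s = 0] they are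
    [(- q)^n / (1 + q^(2n+2))]. *)
Definition Fterm s n :=
  mpoch n * mpoch s / mpoch (n + s).+1 * (- (q * p ^+ s)) ^+ n.

Lemma Fterm_le : exists B : C, forall s n, `|Fterm s n| <= B * `|q| ^+ n.
Proof.
have [B B0 hB] := mpoch_bounded; exists (B * B * B) => s n.
rewrite !normrM normrX; apply: ler_pM; rewrite ?mulr_ge0 ?exprn_ge0 //.
  by apply: ler_pM; rewrite ?mulr_ge0 ?(hB _).2 // ler_pM ?(hB _).1.
rewrite lerXn2r ?nnegrE // normrN normrM ler_piMr // normrX exprn_ile1 //.
by rewrite ltW ?norm_expr2_lt1.
Qed.

(** The sum [F_s]. *)
Definition Fsum s : C := limn (fun n => \sum_(k < n) Fterm s k).

Lemma Fsum_cvg s : (fun n => \sum_(k < n) Fterm s k) @ \oo --> Fsum s.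
Proof.
have [B hB] := Fterm_le.
have [l hl] := geo_summable (normr_ge0 q) q1 (hB s).
by rewrite /Fsum (cvg_seq_lim hl).
Qed.

Lemma Fsum_bounded : exists B : C, forall s, `|Fsum s| <= B.
Proof.
have [B hB] := Fterm_le; exists (B / (1 - `|q|)) => s.
apply: (geo_sum_norm_le (normr_ge0 q) q1 (hB s)).
exact: Fsum_cvg.
Qed.

Lemma Fterm_telescope s n : let x := p ^+ s in
  (1 + x * p) * (1 + x * q) * Fterm s n
    + (1 - x * p) * (x * p * q) * Fterm s.+1 n =
  (1 + x * p) * (Fterm s n - Fterm s n.+1).
Proof.
move=> x; rewrite /Fterm addnS addSn !mpochS.
have := one_add_p_neq0 (n + s).+1; have := one_add_p_neq0 (n + s).
have := mpoch_neq0 (n + s).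
have -> : p ^+ (n + s).+2 = p ^+ n * p ^+ 2 * x.
  by rewrite /x -!exprD; congr (_ ^+ _); lia.
have -> : p ^+ (n + s).+1 = p ^+ n * p * x.
  by rewrite /x -exprSr -exprD; congr (_ ^+ _); lia.
rewrite [p ^+ s.+1]exprSr -/x [p ^+ n.+1]exprSr [_ ^+ n.+1]exprS.
have -> : (- (q * (x * p))) ^+ n = p ^+ n * (- (q * x)) ^+ n.
  by rewrite -exprMn; congr (_ ^+ _); ring.
have -> : q ^+ 2 ^+ 2 = q ^+ 4 by rewrite -exprM.
by move=> h1 h2 h3; field; rewrite h1 h2 h3.
Qed.

Lemma expr_le1 (x : C) s : `|x| < 1 -> `|x ^+ s| <= 1.
Proof. by move=> x1; rewrite normrX exprn_ile1 // ltW. Qed.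

Let p1 := norm_expr2_lt1 q1.

Lemma Fsum_eq s : let x := p ^+ s in
  (1 + x * p) * (1 + x * q) * Fsum s + (1 - x * p) * (x * p * q) * Fsum s.+1 = 1.
Proof.
move=> x; set a := (1 + x * p) * (1 + x * q); set b := (1 - x * p) * (x * p * q).
have h : (fun n => a * (\sum_(k < n) Fterm s k) + b * (\sum_(k < n) Fterm s.+1 k))
    @ \oo --> a * Fsum s + b * Fsum s.+1.
  apply: cvgD; apply: cvgM; [exact: cvg_cst|exact: Fsum_cvg|exact: cvg_cst|].
  exact: Fsum_cvg.
apply: (cvg_seq_unique h).
have [B hB] := Fterm_le.
apply: (@cvg_geo_dist _ _ _ (`|1 + x * p| * B) `|q|) => // n.
have -> : a * (\sum_(k < n) Fterm s k) + b * (\sum_(k < n) Fterm s.+1 k) =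
    1 - (1 + x * p) * Fterm s n.
  elim: n => [|n IH].
    rewrite !big_ord0 /Fterm add0n mpochS expr0 /mpoch qprod0 -/(mpoch s).
    have := one_add_p_neq0 s; have := mpoch_neq0 s.
    by rewrite [p ^+ s.+1]exprSr -/x => h1 h2; field; rewrite h1 h2.
  rewrite !big_ord_recr /= !mulrDr addrACA IH (Fterm_telescope s n) -/x; ring.
by rewrite opprB addrC subrK normrM -mulrA ler_wpM2l.
Qed.

(** The defect of the identity [W(x) = x q E(x) F_s] at [x = p^s]. *)
Definition Vdiff s := Wsum (p ^+ s) - Esum (p ^+ s) * (p ^+ s * q * Fsum s).

Lemma Vdiff_eq s : Vdiff s = - (p ^+ s * q * (1 - p ^+ s.+1)) * Vdiff s.+1.
Proof.
rewrite /Vdiff; have x1 := expr_le1 s p1; have y1 := mul_q_le1 q1 x1.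
rewrite (Wsum_eq x1) (Esum_eq x1) (Esum_eq y1) [p ^+ s.+1]exprSr.
have -> : p ^+ s * q * q = p ^+ s * p by ring.
have := Fsum_eq s => /=; set x := p ^+ s.
set F0 := Fsum s; set F1 := Fsum s.+1 => h.
have -> : (1 + x * q) * ((1 + x * p) * Esum (x * p)) * (x * q * F0) =
  Esum (x * p) * (x * q) * ((1 + x * p) * (1 + x * q) * F0) by ring.
rewrite -[(1 + x * p) * (1 + x * q) * F0](addrK ((1 - x * p) * (x * p * q) * F1)) h.
ring.
Qed.

Lemma Vdiff_bounded : exists B : C, forall s, `|Vdiff s| <= B.
Proof.
have [B hB] := Fsum_bounded.
have [Br hr] := bounded_rpoch q1.
have [Bw hw] := bounded_delay (bounded_ccoef2 q1).
exists (Bw / (1 - `|q|) + Br / (1 - `|q|) * B) => s.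
have x1 := expr_le1 s p1.
apply: le_trans (ler_normB _ _) _; apply: lerD; first exact: thsum_le.
rewrite normrM; apply: ler_pM => //; first exact: thsum_le.
rewrite normrM -[leRHS]mul1r; apply: ler_pM => //; exact: mul_q_le1.
Qed.

Lemma Wsum1 : Wsum 1 = Esum 1 * (q * Fsum 0).
Proof.
(* the factors q^(s^2) (p; p)_s tend to 0, whereas Vdiff s is bounded *)
have V0 s : Vdiff 0 = (-1) ^+ s * q ^+ (s * s) * qprod p p s * Vdiff s.
  elim: s => [|s IH]; first by rewrite !expr0 qprod0 !mul1r.
  rewrite IH Vdiff_eq qprodS exprS.
  have -> : q ^+ (s.+1 * s.+1) = q ^+ (s * s) * (p ^+ s * q).
    by rewrite -exprM -exprSr -exprD; congr (_ ^+ _); lia.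
  by rewrite [(-1) ^+ s.+1]exprS [p ^+ s.+1]exprS; ring.
suff : Vdiff 0 = 0.
  by move/eqP; rewrite /Vdiff expr0 mul1r subr_eq0 => /eqP.
have [B hB] := Vdiff_bounded.
have [D D0 hD] := qprod_bounded (erefl `|p|) p1.
apply: (@cvg_seq_unique _ (fun _ => Vdiff 0)); first exact: cvg_cst.
apply: (@cvg_geo_dist _ _ _ (D * B) `|q|) => // n.
rewrite sub0r normrN (V0 n) !normrM !normrX normrN1 expr1n mul1r -mulrA mulrC.
apply: ler_pM; rewrite ?mulr_ge0 ?exprn_ge0 //.
  by apply: ler_pM; rewrite ?(hD n).1.
by case: n => // n; rewrite ler_wiXn2l ?(ltW q1) // leq_pmulr.
Qed.

(** The iterates of [Esum_eq] at [x = 1], in the limit: a case of Euler's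
    identity. *)
Lemma Esum1 (M : C) : qprod (- q) q @ \oo --> M -> Esum 1 = M.
Proof.
move=> hM.
have E1 s : Esum 1 = qprod (- q) q s * Esum (q ^+ s).
  elim: s => [|s IH]; first by rewrite qprod0 mul1r expr0.
  rewrite IH (Esum_eq (expr_le1 s q1)) qprodNE -exprSr; ring.
have br := bounded_rpoch q1.
have hE : (fun s => Esum (q ^+ s)) @ \oo --> (1 : C).
  have [B hB] := br.
  apply: (@cvg_geo_dist _ _ _ (B / (1 - `|q|)) `|q|) => // s.
  rewrite /Esum thsum_recl ?expr_le1 // /rpoch qprod0 invr1 opprD addrA subrr.
  rewrite sub0r normrN mulrC normrM; apply: ler_pM => //.
    apply: thsum_le => [//||n]; last exact: hB.
    by apply: (mul_q_le1 q1); apply: expr_le1.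
  by rewrite -normrX normrM ler_piMr // ltW.
apply: (cvg_seq_unique (u := fun s => qprod (- q) q s * Esum (q ^+ s))).
  have -> : (fun s => qprod (- q) q s * Esum (q ^+ s)) = fun=> Esum 1.
    by apply/funext => s; rewrite -E1.
  exact: cvg_cst.
by rewrite -[M]mulr1; apply: (cvgM hM hE).
Qed.

(** Jacobi's two-squares identity
    [((q)_oo / (-q)_oo)^2 = 1 + 4 sum_(n >= 1) (-q)^n / (1 + q^(2n))], with [A = (q)_oo] and [M = (-q)_oo]. *)
Lemma two_squares (A M : C) : A != 0 ->
  qprod q q @ \oo --> A -> qprod (- q) q @ \oo --> M ->
  M ^+ 2 * (1 - 4 * (q * Fsum 0)) = A ^+ 2.
Proof.
move=> A0 hA hM; pose c := M / A.
have hV : (fun n => (qprod q q n)^-1) @ \oo --> A^-1 by exact: (cvgV A0 hA).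
have hc : (fun n => qprod (- q) q n * (qprod q q n)^-1) @ \oo --> c.
  exact: (cvgM hM hV).
have {}hc : cratio q @ \oo --> c by exact: hc.
have [B1 B10 hB1] := qprod_bounded (normrN q) q1.
have [B2 B20 hB2] := qprod_bounded (erefl `|q|) q1.
have cB n : `|cratio q n| <= B1 * B2.
  by rewrite normrM ler_pM ?(hB1 n).1 ?(hB2 n).2.
have [D hD] := Fterm_le.
have tE N k : tsq_term q N k =
    (- q * (cratio q (N + k.+1) * cratio q (N - k.+1))) * Fterm 0 k.
  rewrite /tsq_term /Fterm addn0 mpochS [mpoch 0]qprod0 expr0 !mulr1 exprS.
  by have := mpoch_neq0 k; have := one_add_p_neq0 k => h1 h2; field; rewrite h1 h2.
have hS : (fun N => \sum_(k < N) tsq_term q N k) @ \oo --> (- q * c ^+ 2) * Fsum 0.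
  apply: (tannery (u := fun k => (- q * c ^+ 2) * Fterm 0 k)
           (B := (B1 * B2) ^+ 2 * D) (normr_ge0 q) q1).
  - move=> N k _; rewrite tE normrM -mulrA; apply: ler_pM => //.
    rewrite normrM normrN -[leRHS]mul1r; apply: ler_pM => //; first exact: ltW.
    by rewrite normrM expr2; apply: ler_pM.
  - move=> k.
    have -> : (fun N => tsq_term q N k) = fun N =>
       (- q * (cratio q (N + k.+1) * cratio q (N - k.+1))) * Fterm 0 k.
      by apply/funext => N; exact: tE.
    apply: cvgM; last exact: cvg_cst.
    apply: cvgM; first exact: cvg_cst.
    rewrite expr2; move/cvg_seqP: hc => hc.
    apply: cvgM; apply/cvg_seqP => e /hc [N hN].
      by exists N => n Nn; apply: hN; lia.
    by exists (N + k.+1)%N => n Nn; apply: hN; lia.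
  - have -> : (fun n => \sum_(k < n) - q * c ^+ 2 * Fterm 0 k) =
       fun n => - q * c ^+ 2 * \sum_(k < n) Fterm 0 k.
      by apply/funext => n; rewrite mulr_sumr.
    by apply: cvgM; [exact: cvg_cst|exact: Fsum_cvg].
have h1 : c ^+ 2 + 4 * ((- q * c ^+ 2) * Fsum 0) = 1.
  apply: (cvg_seq_unique
    (u := fun N => cratio q N ^+ 2 + 4 * \sum_(k < N) tsq_term q N k)).
    apply: cvgD; first by rewrite expr2; apply: (cvgM hc hc).
    by apply: cvgM; [exact: cvg_cst|exact: hS].
  have -> : (fun N => cratio q N ^+ 2 + 4 * \sum_(k < N) tsq_term q N k) = fun=> 1.
    by apply/funext => N; exact: two_squares_fin.
  exact: cvg_cst.
rewrite -[RHS]mulr1 -[X in _ = _ * X]h1 /c; field; exact: A0.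
Qed.

End FunctionalEquations.

(** * Triple sums over [i + 2k + 2j < N] *)

Section TripleSums.
Variable F : comPzRingType.
Implicit Types (f g w : nat -> F).

(** The triples [(i, j, k)] with [i + 2k + 2j < N], without repetition. *)
Definition triples (N : nat) : seq (nat * nat * nat) :=
  map (fun t : 'I_N * 'I_N * 'I_N => (t.1.1 : nat, t.1.2 : nat, t.2 : nat))
    [seq t : 'I_N * 'I_N * 'I_N <- enum {: 'I_N * 'I_N * 'I_N}
      | (t.1.1 + 2 * t.2 + 2 * t.1.2 < N)%N].

Lemma triples_uniq N : uniq (triples N).
Proof.
rewrite map_inj_uniq; first by apply: filter_uniq; exact: enum_uniq.
by move=> [[a b] c] [[a' b'] c'] [] /val_inj -> /val_inj -> /val_inj ->.
Qed.

Lemma mem_triples N t :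
  (t \in triples N) = (t.1.1 + 2 * t.2 + 2 * t.1.2 < N)%N.
Proof.
apply/mapP/idP => [[[[a b] c]] | ].
  by rewrite mem_filter => /andP[h _] ->.
case: t => [[i j] k] /= h.
have hi : (i < N)%N by lia.
have hj : (j < N)%N by lia.
have hk : (k < N)%N by lia.
by exists (Ordinal hi, Ordinal hj, Ordinal hk); rewrite // mem_filter /= h mem_enum.
Qed.

Lemma big_triples N (G : nat -> nat -> nat -> F) :
  \sum_(t <- triples N) G t.1.1 t.1.2 t.2 =
  \sum_(i < N) \sum_(j < N) \sum_(k < N | (i + 2 * k + 2 * j < N)%N) G i j k.
Proof.
rewrite big_map big_filter big_enum_cond /=.
under [RHS]eq_bigr => i _ do rewrite pair_big_dep /=.
rewrite pair_big_dep /=.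
rewrite (reindex (fun t : 'I_N * ('I_N * 'I_N) => (t.1, t.2.1, t.2.2))) /=.
  by apply: eq_bigl => -[i [j k]].
exists (fun t : 'I_N * 'I_N * 'I_N => (t.1.1, (t.1.2, t.2))) => [[i [j k]]|[[i j] k]] //.
Qed.

Lemma sum_cprod_spread N w g delta :
  \sum_(n < N) w n * cprod g (spread delta) n =
  \sum_(j < N) \sum_(n < N | (n + 2 * j < N)%N) w (n + 2 * j)%N * g n * delta j.
Proof.
have cE n : (n < N)%N -> cprod g (spread delta) n =
    \sum_(j < N) \sum_(m < N | (m + 2 * j == n)%N) g m * delta j.
  move=> nN; rewrite /cprod (exchange_big_dep xpredT) //=.
  rewrite (big_ord_widen N (fun i => g i * spread delta (n - i))) //.
  rewrite big_mkcond /=; apply: eq_bigr => i _; rewrite /spread.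
  case: ifP => [iN|/negbT iN].
    case: ifP => [on|/negbT on].
      rewrite mulr0 big1 // => j /eqP h; exfalso.
      by move: on; rewrite -h addKn mul2n odd_double.
    have jN : ((n - i)./2 < N)%N by have := odd_double_half (n - i); lia.
    rewrite (big_pred1 (Ordinal jN)) // => j /=.
    have := odd_double_half (n - i); rewrite (negbTE on) -val_eqE /=; lia.
  by rewrite big1 // => j /eqP h; exfalso; move: iN; lia.
under eq_bigr => n _ do rewrite (cE n (ltn_ord n)) mulr_sumr.
rewrite exchange_big /=; apply: eq_bigr => j _.
under eq_bigr => n _ do rewrite mulr_sumr.
rewrite (exchange_big_dep xpredT) //= [RHS]big_mkcond /=.
apply: eq_bigr => m _; case: ifP => [h|/negbT h].
  rewrite (big_pred1 (Ordinal h)) /=; first by rewrite mulrA.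
  by move=> n /=; apply/eqP/eqP => [e|->] //; apply: val_inj.
by rewrite big1 // => n /eqP hn; move: h; rewrite hn ltn_ord.
Qed.

(** Summing over i + 2k first and then over i + 2k + 2j turns the triple sum
    into a sum of iterated Cauchy products. *)
Lemma sum_triples N (w kappa e delta : nat -> F) :
  \sum_(t <- triples N) w (t.1.1 + 2 * t.2 + 2 * t.1.2)%N * kappa (t.1.1 + 2 * t.2)%N
      * e t.1.1 * (delta t.1.2 * delta t.2) =
  \sum_(M < N) w M * cprod (fun n => kappa n * cprod e (spread delta) n)
                      (spread delta) M.
Proof.
rewrite (big_triples _ (fun i j k => w (i + 2 * k + 2 * j)%N * kappa (i + 2 * k)%N
   * e i * (delta j * delta k))) sum_cprod_spread exchange_big /=.
apply: eq_bigr => j _.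
pose w' n := if (n + 2 * j < N)%N then w (n + 2 * j)%N * kappa n * delta j else 0.
transitivity (\sum_(n < N) w' n * cprod e (spread delta) n).
  rewrite sum_cprod_spread [RHS](exchange_big_dep xpredT) //=.
  apply: eq_bigr => i _; rewrite [LHS]big_mkcond [RHS]big_mkcond /=.
  apply: eq_bigr => k _; rewrite /w'.
  case: ifP => h.
    by rewrite (_ : (i + 2 * k < N)%N); [ring|lia].
  by case: ifP => // _; rewrite !mul0r.
rewrite [RHS]big_mkcond /=; apply: eq_bigr => n _; rewrite /w'.
by case: ifP => // _; [ring|rewrite mul0r].
Qed.

End TripleSums.

(** * Unconditional convergence *)

Section Unconditional.
Variable R : realType.
Local Notation C := R[i].
Local Open Scope classical_set_scope.

Lemma ler_sum_subseq (T : choiceType) (s s' : seq T) (P : pred T) (g : T -> C) :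
  uniq s -> uniq s' -> {subset s <= s'} -> (forall t, 0 <= g t) ->
  \sum_(t <- s | P t) g t <= \sum_(t <- s' | P t) g t.
Proof.
move=> us us' ss' g0.
have pe : perm_eq s [seq t <- s' | t \in s].
  apply: uniq_perm => //; first exact: filter_uniq.
  by move=> t; rewrite mem_filter; case: (boolP (t \in s)) => [/ss' ->|].
rewrite (perm_big _ pe) big_filter_cond /= [leRHS](bigID (mem s)) /=.
rewrite (eq_bigl (fun t => P t && (t \in s))); last by move=> t; rewrite andbC.
by rewrite lerDl sumr_ge0.
Qed.

(** Unconditional summability follows from convergence along the exhaustion of
    [nat^3] by the sets [i + 2k + 2j < N], given a bound on the tails of the
    norms that tends to 0. *)
Lemma sum3_is_triples (f : nat -> nat -> nat -> C) (l : C) (T : nat -> C) :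
  (fun N => \sum_(t <- triples N) f t.1.1 t.1.2 t.2) @ \oo --> l ->
  (forall N d, \sum_(t <- triples (N + d) | t \notin triples N)
                 `|f t.1.1 t.1.2 t.2| <= T N) ->
  T @ \oo --> (0 : C) -> sum3_is f l.
Proof.
move=> /cvg_seqP fl fT /cvg_seqP T0.
have FF : Filter (@totally (nat * nat * nat)%type) := @filter_filter _ _ totally_filter.
apply/cvgrPdist_lt => e e0.
pose g t := f t.1.1 t.1.2 t.2.
have e2 : 0 < e / 2 by rewrite divr_gt0.
have [N1 hN1] := fl _ e2; have [N2 hN2] := T0 _ e2.
pose N := maxn N1 N2.
have {hN1}h1 := hN1 N (leq_maxl _ _); have {hN2}h2 := hN2 N (leq_maxr _ _).
have TN0 : 0 <= T N by apply: le_trans (fT N 0%N); rewrite sumr_ge0.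
rewrite sub0r normrN ger0_norm // in h2.
exists [fset t in triples N]%fset => // B /= /fsubsetP AB.
have pB : partial_sum g B = \sum_(t <- B) g t by rewrite big_seq_fsetE.
rewrite -/g pB (bigID (mem (triples N))) /=.
have -> : \sum_(t <- B | t \in triples N) g t = \sum_(t <- triples N) g t.
  rewrite -big_filter; apply: perm_big; apply: uniq_perm.
  - exact: filter_uniq (fset_uniq B).
  - exact: triples_uniq.
  move=> t; rewrite mem_filter; case: (boolP (t \in triples N)) => //= tN.
  by apply: AB; rewrite inE.
rewrite opprD addrA; apply: le_lt_trans (ler_normB _ _) _.
have -> : e = e / 2 + e / 2 by field.
apply: ltrD => //; apply: le_lt_trans h2; apply: le_trans (ler_norm_sum _ _ _) _.
(* B is contained in the triples of weight less than N + d *)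
pose d := (\max_(t <- B) (t.1.1 + 2 * t.2 + 2 * t.1.2)).+1.
apply: le_trans (fT N d); apply: ler_sum_subseq => //.
- exact: triples_uniq.
move=> t tB; rewrite mem_triples.
have := @leq_bigmax_seq _ (enum_fset B) xpredT
  (fun t : nat * nat * nat => (t.1.1 + 2 * t.2 + 2 * t.1.2)%N) t tB isT.
by rewrite /d addnS ltnS => h; apply: leq_trans h (leq_addl _ _).
Qed.

(** For a summand of the shape of both triple sums, it suffices to find majorants
    of the factors for which the sums over [i + 2k + 2j = M] decay
    geometrically. *)
Lemma sum3_is_cprod (w kappa e delta W K E D : nat -> C) (B Q l : C) :
  0 <= Q -> Q < 1 ->
  (forall n, `|w n| <= W n) -> (forall n, `|kappa n| <= K n) ->
  (forall n, `|e n| <= E n) -> (forall n, `|delta n| <= D n) ->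
  (forall M, W M * cprod (fun n => K n * cprod E (spread D) n) (spread D) M
             <= B * Q ^+ M) ->
  (fun N => \sum_(M < N) w M *
     cprod (fun n => kappa n * cprod e (spread delta) n) (spread delta) M)
    @ \oo --> l ->
  sum3_is (fun i j k => w (i + 2 * k + 2 * j)%N * kappa (i + 2 * k)%N * e i
                        * (delta j * delta k)) l.
Proof.
move=> Q0 Q1 hw hk he hd hB hl.
have nn (f F : nat -> C) : (forall n, `|f n| <= F n) -> forall n, 0 <= F n.
  by move=> h n; apply: le_trans (h n).
have cp0 (f g : nat -> C) n : (forall n, 0 <= f n) -> (forall n, 0 <= g n) ->
    0 <= cprod f g n.
  by move=> f0 g0; apply: sumr_ge0 => i _; rewrite mulr_ge0.
have sp0 n : 0 <= spread D n by rewrite /spread; case: (odd n) => //; exact: nn hd _.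
have B0 : 0 <= B.
  have := hB 0%N; rewrite expr0 mulr1; apply: le_trans.
  apply: mulr_ge0; first exact: nn hw _.
  apply: (cp0) => // n; apply: mulr_ge0; first exact: nn hk _.
  by apply: cp0 => // m; exact: nn he _.
apply: (@sum3_is_triples _ _ (fun N => B * Q ^+ N / (1 - Q))).
- rewrite (_ : (fun N => _) = (fun N => \sum_(M < N) w M *
     cprod (fun n => kappa n * cprod e (spread delta) n) (spread delta) M)) //.
  by apply/funext => N; rewrite -sum_triples.
- move=> N d.
  pose G (t : nat * nat * nat) := W (t.1.1 + 2 * t.2 + 2 * t.1.2)%N *
    K (t.1.1 + 2 * t.2)%N * E t.1.1 * (D t.1.2 * D t.2).
  have fG t : `|w (t.1.1 + 2 * t.2 + 2 * t.1.2)%N * kappa (t.1.1 + 2 * t.2)%N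
      * e t.1.1 * (delta t.1.2 * delta t.2)| <= G t.
    rewrite !normrM /G; do !(apply: ler_pM; rewrite ?mulr_ge0 ?normr_ge0 //).
  apply: le_trans (ler_sum _ (fun t _ => fG t)) _.
  have NN : {subset triples N <= triples (N + d)}.
    by move=> t; rewrite !mem_triples; lia.
  have eN : \sum_(t <- triples (N + d) | t \in triples N) G t =
      \sum_(t <- triples N) G t.
    rewrite -big_filter; apply: perm_big; apply: uniq_perm.
    - exact: filter_uniq (triples_uniq _).
    - exact: triples_uniq.
    move=> t; rewrite mem_filter; case: (boolP (t \in triples N)) => //= tN.
    exact: NN.
  have -> : \sum_(t <- triples (N + d) | t \notin triples N) G t =
     \sum_(t <- triples (N + d)) G t - \sum_(t <- triples N) G t.
    by rewrite [X in _ = X - _](bigID (mem (triples N))) /= eN addrC addrK.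
  pose S M := W M * cprod (fun n => K n * cprod E (spread D) n) (spread D) M.
  have SN m : \sum_(t <- triples m) G t = \sum_(M < m) S M by rewrite -sum_triples.
  rewrite !SN (sum_ord_split S (leq_addr d N)) [_ + _ - _]addrAC subrr add0r addKn.
  apply: le_trans (geo_sum_le N d B0 Q0 Q1); apply: ler_sum => k _; exact: hB.
- apply: (@cvg_geo_dist _ _ _ (B / (1 - Q)) Q) => // n.
  rewrite sub0r normrN ger0_norm ?mulr_ge0 ?exprn_ge0 ?invr_ge0 ?subr_ge0 ?(ltW Q1) //.
  by rewrite mulrAC.
Qed.

End Unconditional.

(** * The two triple sums *)

Section Nahm.
Variables (R : realType) (q : R[i]).
Hypothesis q1 : `|q| < 1.
Local Notation C := R[i].
Local Notation p := (q ^+ 2).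
Local Notation Q := `|q|.
Local Open Scope classical_set_scope.

Lemma thsum_ccoef : thsum q (ccoef q) 1 = Esum q 1 - Wsum q 1.
Proof.
have n1 : `|1 : C| <= 1 by rewrite normr1.
apply/eqP; rewrite eq_sym subr_eq; apply/eqP; rewrite /Esum /Wsum -thsumD //.
- by apply: eq_thsum => n; apply: rpoch_ccoef; exact: one_sub_expr_neq0.
- exact: bounded_ccoef.
- by apply: bounded_delay; exact: bounded_ccoef2.
Qed.

Lemma thsum_ccoef2 : q * thsum q (ccoef2 q) q = Wsum q 1.
Proof.
by rewrite /Wsum thsum_delay ?normr1 ?mul1r //; exact: bounded_ccoef2.
Qed.

Lemma triple_sum1 : sum3_is
  (fun i j k => q ^+ 'C((i + 2 * k + 2 * j).+1, 2) * q ^+ 'C(i + 2 * k, 2)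
     * ecoef q i * ((qprod p p j)^-1 * (qprod p p k)^-1))
  (Esum q 1 - Wsum q 1).
Proof.
have [B hB] := rpoch_bounded q1.
apply: (@sum3_is_cprod _ (fun n => q ^+ 'C(n.+1, 2)) (fun n => q ^+ 'C(n, 2))
  (ecoef q) (fun j => (qprod p p j)^-1) (fun n => Q ^+ 'C(n.+1, 2))
  (fun n => Q ^+ 'C(n, 2)) (ecoef Q) (fun j => (qprod (Q ^+ 2) (Q ^+ 2) j)^-1) B Q) => //.
- by move=> n; rewrite normrX.
- by move=> n; rewrite normrX.
- exact: norm_ecoef_le.
- exact: norm_qprod2V_le.
- move=> M; rewrite mulrC; apply: ler_pM; rewrite ?exprn_ge0 //.
  + exact: le_trans (norm_ccoef_le q1 M).
  + exact: le_trans (ccoef_le q1 M) (hB M).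
  + by rewrite ler_wiXn2l ?leq_bin2 // ltW.
- rewrite -thsum_ccoef.
  apply: eq_cvg_seq (thsum_cvg q1 (x := 1) _ (bounded_ccoef q1)) => [N|].
    by apply: eq_bigr => k _; rewrite expr1n mulr1.
  by rewrite normr1.
Qed.

Lemma triple_sum2 : sum3_is
  (fun i j k => q ^+ ('C((i + 2 * k + 2 * j).+1, 2) + (i + 2 * k + 2 * j))
     * q ^+ (i + 2 * k + 'C(i + 2 * k, 2))
     * ecoef q i * ((qprod p p j)^-1 * (qprod p p k)^-1))
  (thsum q (ccoef2 q) q).
Proof.
have [B hB] := rpoch_bounded q1.
have c2E (z : C) M : cprod (fun n => z ^+ (n + 'C(n, 2)) * cprod (ecoef z) (dpoch z) n)
   (dpoch z) M = ccoef2 z M.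
  by apply: eq_cprod => // n; rewrite exprD -mulrA.
apply: (@sum3_is_cprod _ (fun n => q ^+ ('C(n.+1, 2) + n)) (fun n => q ^+ (n + 'C(n, 2)))
  (ecoef q) (fun j => (qprod p p j)^-1) (fun n => Q ^+ ('C(n.+1, 2) + n))
  (fun n => Q ^+ (n + 'C(n, 2))) (ecoef Q) (fun j => (qprod (Q ^+ 2) (Q ^+ 2) j)^-1) B Q) => //.
- by move=> n; rewrite normrX.
- by move=> n; rewrite normrX.
- exact: norm_ecoef_le.
- exact: norm_qprod2V_le.
- move=> M; rewrite mulrC [X in X * _]c2E; apply: ler_pM; rewrite ?exprn_ge0 //.
  + exact: le_trans (norm_ccoef2_le q1 M).
  + exact: le_trans (ccoef2_le q1 M) (hB _).
  + by rewrite ler_wiXn2l ?leq_addl // ltW.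
- apply: eq_cvg_seq (thsum_cvg q1 (ltW q1) (bounded_ccoef2 q1)) => N.
  by apply: eq_bigr => k _; rewrite [X in _ * X = _]c2E exprD.
Qed.

End Nahm.

Theorem theorem1p4 (R : realType) (q : R[i]) (q_lt1 : `|q| < 1) :
  sum3_is
    (fun i j k : nat =>
       q ^+ ((3 * i ^ 2 + i) %/ 2 + 2 * j ^ 2 + 4 * k ^ 2
             + 2 * i * j + 4 * i * k + 4 * j * k + j)%N
       / (qpoch q q i * qpoch (q ^+ 2) (q ^+ 2) j * qpoch (q ^+ 2) (q ^+ 2) k))
    (4^-1 * (3 * (qpoch_inf (q ^+ 2) (q ^+ 2) / qpoch_inf q q)
             + qpoch_inf q q ^+ 3 / qpoch_inf (q ^+ 2) (q ^+ 2)))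
  /\
  (q != 0 ->
   sum3_is
     (fun i j k : nat =>
        q ^+ ((3 * i ^ 2 + 5 * i) %/ 2 + 2 * j ^ 2 + 4 * k ^ 2
              + 2 * i * j + 4 * i * k + 4 * j * k + 3 * j + 4 * k)%N
        / (qpoch q q i * qpoch (q ^+ 2) (q ^+ 2) j * qpoch (q ^+ 2) (q ^+ 2) k))
     (4^-1 * q^-1 * (qpoch_inf (q ^+ 2) (q ^+ 2) / qpoch_inf q q
                     - qpoch_inf q q ^+ 3 / qpoch_inf (q ^+ 2) (q ^+ 2)))).
Proof.
have [A A0 hA] := qprod_cvg (erefl `|q|) q_lt1.
have [M M0 hM] := qprod_cvg (normrN q) q_lt1.
have hP : (qprod (q ^+ 2) (q ^+ 2) @ \oo --> A * M)%classic.
  have -> : qprod (q ^+ 2) (q ^+ 2) = fun n => qprod q q n * qprod (- q) q n.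
    apply/funext => n; rewrite /qprod -big_split /=; apply: eq_bigr => k _.
    by rewrite [q ^+ 2 ^+ k]exprAC; ring.
  exact: (cvgM hA hM).
have eA : qpoch_inf q q = A by exact: cvg_seq_lim hA.
have eP : qpoch_inf (q ^+ 2) (q ^+ 2) = A * M by exact: cvg_seq_lim hP.
have two := two_squares q_lt1 A0 hA hM.
have W1 := Wsum1 q_lt1; have E1 := Esum1 q_lt1 hM; rewrite E1 in W1.
have qE a p n : qpoch a p n = qprod a p n :> R[i] by [].
have expD3 a b c : q ^+ (a + b + c) = q ^+ a * q ^+ b * q ^+ c by rewrite !exprD.
have quot1 : A * M / A = M by field.
have quot2 : A ^+ 3 / (A * M) = M - 4 * Wsum q 1.
  rewrite W1 -[A ^+ 3]/(A * A ^+ 2) -two; field; exact/andP.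
rewrite eA eP quot1 quot2; split=> [|q0].
  rewrite (_ : 4^-1 * _ = Esum q 1 - Wsum q 1); last by rewrite E1; field.
  have := triple_sum1 q_lt1; congr sum3_is.
  apply/funext => i; apply/funext => j; apply/funext => k.
  by rewrite exponent1E expD3 /ecoef /rpoch !qE !invfM; ring.
rewrite (_ : 4^-1 * _ * _ = thsum q (ccoef2 q) q).
  have := triple_sum2 q_lt1; congr sum3_is.
  apply/funext => i; apply/funext => j; apply/funext => k.
  by rewrite exponent2E (expD3 ('C(_, 2) + _)%N) /ecoef /rpoch !qE !invfM; ring.
by rewrite -(thsum_ccoef2 q_lt1); field.
Qed.
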